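(* If $a=\{a_j\}_{j\ge1}$ is any positive, summable, decreasing sequence, then $\dim_L E\le\dim_L C_a$ for any complementary set $E\in\mathcal{C}_a$.
   Context: Decreasing means $a_j\ge a_{j+1}$ for all $j$. Let $L=\sum_j a_j$. The family $\mathcal{C}_a$ of complementary sets of $a$ consists of the closed subsets $E$ of $[0,L]$ of the form $E=[0,L]\setminus\bigcup_{j=1}^\infty U_j$, where $\{U_j\}$ is a disjoint family of open intervals contained in $[0,L]$ with the length of $U_j$ equal to $a_j$ for each $j$. The associated Cantor set $C_a\in\mathcal{C}_a$ is constructed as follows. From $I=[0,L]$ remove an open interval of length $a_1$, leaving two closed intervals $I^1_1$ and $I^1_2$ (left to right). Having constructed the closed intervals $I^k_1,\dots,I^k_{2^k}$ of step $k$ (left to right), remove from each $I^k_j$ an open interval of length $a_{2^k+j-1}$, leaving the closed intervals $I^{k+1}_{2j-1}$ and $I^{k+1}_{2j}$. The positions are uniquely determined by requiring that the length of each $I^k_j$ equal the sum of the lengths of all the open intervals subsequently removed from it. Then $C_a=\bigcap_{k\ge1}\bigcup_{j=1}^{2^k}I^k_j$. For non-empty $F\subset\mathbb{R}$, $N_r(F)$ denotes the minimum number of closed balls of radius $r$ needed to cover $F$, and $B(x,R)$ is the closed ball of radius $R$ centred at $x$. The Lower Assouad dimension is $$\dim_L F=\sup\Bigl\{\alpha:\ \exists\, c,\rho>0 \text{ such that } \inf_{x\in F}N_r(B(x,R)\cap F)\ge c\left(\tfrac{R}{r}\right)^{\alpha}\text{ for all }0<r<R<\rho\Bigr\}.$$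 *)

(* Defs.v *)
From HB Require Import structures.
From mathcomp Require Import all_boot all_order all_algebra.
From mathcomp Require Import all_classical all_reals all_analysis.
From mathcomp Require Import zify lra.

Set Implicit Arguments.
Unset Strict Implicit.
Unset Printing Implicit Defensive.

Import Order.TTheory GRing.Theory Num.Theory.
Import numFieldNormedType.Exports.

Local Open Scope classical_set_scope.
Local Open Scope ring_scope.

(* A sequence a_1, a_2, ... is encoded as a : R^nat with a j standing for the
   mathematical a_(j+1). *)

Section Definitions.
Variable R : realType.
Implicit Types (a : R^nat) (E F : set R).

Definition total_length a : R := limn (series a).

(* Such an E is automatically closed, being [0, L] minus an open set. *)
Definition complementary_set a E : Prop :=
  exists U : nat -> set R,
    [/\ forall j, exists x y : R, U j = `]x, y[%classic /\
          y - x = a j,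
        forall j, U j `<=` `[0, total_length a]%classic,
        trivIset setT U
      & E = `[0, total_length a]%classic `\` \bigcup_j U j].

(* The intervals of step k are indexed from left to right by 0 <= j < 2 ^ k,
   step 0 being [0, L] alone; the children of interval j of step k are the
   intervals 2j and 2j + 1 of step k + 1.  The gap removed from interval j of
   step k is the mathematical a_(2 ^ k + j). *)
Definition cantor_gap a (k j : nat) : R := a (2 ^ k + j).-1.

(* The descendants at step k + i of interval j of step k are the intervals
   j * 2 ^ i + m with m < 2 ^ i; cantor_length sums the gaps removed from all
   of them, i = 0, 1, ... *)
Definition cantor_block a (k j i : nat) : R :=
  \sum_(m < 2 ^ i) cantor_gap a (k + i) (j * 2 ^ i + m).

Definition cantor_length a (k j : nat) : R :=
  limn (series (cantor_block a k j)).

(* Endpoints of interval j of step k.  The position of the gap in the parent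
   is dictated by the length required of the left child; that the right child
   then has the required length too is the lemma cantor_ends_length. *)
Fixpoint cantor_ends a (k j : nat) : R * R :=
  if k is k'.+1 then
    let: (x, y) := cantor_ends a k' j./2 in
    let u := x + cantor_length a k (j./2).*2 in
    if odd j then (u + cantor_gap a k' j./2, y) else (x, u)
  else (0, total_length a).

Definition cantor_interval a (k j : nat) : set R :=
  `[(cantor_ends a k j).1, (cantor_ends a k j).2]%classic.

Definition cantor_set a : set R :=
  \bigcap_(k in [set k | (1 <= k)%N])
    \bigcup_(j in [set j | (j < 2 ^ k)%N]) cantor_interval a k j.

(* +oo if F is not covered by finitely many balls; the centres need not lie
   in F. *)
Definition covering_number (r : R) F : \bar R :=
  ereal_inf [set n%:R%:E | n in [set n : nat |
    exists c : 'I_n -> R, F `<=` \bigcup_i closed_ball (c i) r]].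

Definition lower_assouad_dim F : \bar R :=
  ereal_sup [set alpha%:E | alpha in [set alpha : R |
    exists c rho : R, [/\ 0 < c, 0 < rho &
      forall r s : R, 0 < r -> r < s -> s < rho ->
        ((c * (s / r) `^ alpha)%:E <=
          ereal_inf [set covering_number r (closed_ball x s `&` F)
                    | x in F])%E]]].

End Definitions.

Section CantorLengths.
Variables (R : realType) (a : R^nat).
Hypothesis a0 : forall j : nat, 0 < a j.
Hypothesis ca : cvgn (series a).

Lemma series_cantor_block0 n :
  series (cantor_block a 0 0) n = series a (2 ^ n).-1.
Proof.
elim: n => [|n IH]; first by rewrite /series /= !big_geq.
rewrite seriesSr IH /cantor_block /series /= add0n.
have -> : ((2 ^ n.+1).-1 = (2 ^ n).-1 + 2 ^ n)%N
  by have := expn_gt0 2 n; rewrite expnS; lia.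
rewrite [RHS](big_cat_nat _ (n := (2 ^ n).-1)) ?leq_addr//=; congr (_ + _).
rewrite -[X in \sum_(X <= _ < _) _]add0n big_addn addKn big_mkord.
apply: eq_bigr => m _; rewrite /cantor_gap mul0n !add0n; congr a.
have := expn_gt0 2 n; lia.
Qed.

Lemma cantor_block_ge0 k j i : 0 <= cantor_block a k j i.
Proof. by apply: sumr_ge0 => m _; apply/ltW/a0. Qed.

Lemma cantor_block_split k j i :
  cantor_block a k j i.+1 =
  cantor_block a k.+1 j.*2 i + cantor_block a k.+1 j.*2.+1 i.
Proof.
rewrite /cantor_block expnS mul2n -addnn big_split_ord /=; congr (_ + _);
  apply: eq_bigr => m _; rewrite /cantor_gap addnS addSn; congr a;
  congr (_.-1); congr (_ + _)%N; rewrite -muln2; lia.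
Qed.

Lemma series_cantor_blockS k j n :
  series (cantor_block a k j) n.+1 = cantor_gap a k j +
    (series (cantor_block a k.+1 j.*2) n + series (cantor_block a k.+1 j.*2.+1) n).
Proof.
rewrite /series /= big_nat_recl//; congr (_ + _).
  by rewrite /cantor_block expn0 big_ord1 /= addn0 muln1 addn0.
by rewrite -big_split /=; apply: eq_bigr => i _; exact: cantor_block_split.
Qed.

Lemma cvg_cantor_block0 : series (cantor_block a 0 0) @ \oo --> limn (series a).
Proof.
rewrite (_ : series (cantor_block a 0 0) =
    series a \o (fun n => (2 ^ n).-1)); last first.
  by apply/funext => n; exact: series_cantor_block0.
apply: (@cvg_comp _ _ _ (fun n => (2 ^ n).-1) (series a) _ \oo); last exact: ca.
move=> A [N _ NA]; exists N => // n /= Nn; apply: NA => /=.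
have := ltn_expl n (isT : 1 < 2)%N; lia.
Qed.

Lemma cvg_cantor_block k j : (j < 2 ^ k)%N ->
  cvgn (series (cantor_block a k j)).
Proof.
elim: k j => [|k IH] j jk.
  have -> : j = 0%N by rewrite expn0 in jk; lia.
  by apply/cvg_ex; exists (limn (series a)); exact: cvg_cantor_block0.
have {}IH : cvgn (series (cantor_block a k j./2))
  by apply: IH; rewrite expnS in jk; lia.
apply: nondecreasing_is_cvgn.
  by apply: nondecreasing_series => i _ _; exact: cantor_block_ge0.
exists (limn (series (cantor_block a k j./2))) => _ [n _ <-].
apply: (@le_trans _ _ (series (cantor_block a k j./2) n.+1)); last first.
  apply: nondecreasing_cvgn_le => //.
  by apply: nondecreasing_series => i _ _; exact: cantor_block_ge0.
rewrite series_cantor_blockS.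
have g0 : 0 < cantor_gap a k j./2 by exact: a0.
have s0 k' j' : 0 <= series (cantor_block a k' j') n
  by apply: sumr_ge0 => ? _; exact: cantor_block_ge0.
have s1 := s0 k.+1 j./2.*2; have s2 := s0 k.+1 j./2.*2.+1.
have [->|->] : (j = j./2.*2 \/ j = j./2.*2.+1)%N by lia.
  rewrite !doubleK; lra.
rewrite /= !uphalf_double; lra.
Qed.

Lemma cantor_length_split k j : (j < 2 ^ k)%N ->
  cantor_length a k j =
  cantor_length a k.+1 j.*2 + cantor_gap a k j + cantor_length a k.+1 j.*2.+1.
Proof.
move=> jk.
have c1 : cvgn (series (cantor_block a k.+1 j.*2))
  by apply: cvg_cantor_block; rewrite expnS; lia.
have c2 : cvgn (series (cantor_block a k.+1 j.*2.+1))
  by apply: cvg_cantor_block; rewrite expnS; lia.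
rewrite (addrC (cantor_length _ _ _)) -addrA.
apply/cvg_lim => //; rewrite -cvg_shiftS.
rewrite (_ : (fun n => _) = (fun n => cantor_gap a k j +
    (series (cantor_block a k.+1 j.*2) n +
     series (cantor_block a k.+1 j.*2.+1) n))); last first.
  by apply/funext => n; exact: series_cantor_blockS.
by apply: cvgD; [exact: cvg_cst|apply: cvgD].
Qed.

Lemma cantor_length00 : cantor_length a 0 0 = total_length a.
Proof. by apply/cvg_lim => //; exact: cvg_cantor_block0. Qed.

Lemma cantor_ends_length k j : (j < 2 ^ k)%N ->
  (cantor_ends a k j).2 - (cantor_ends a k j).1 = cantor_length a k j.
Proof.
elim: k j => [|k IH] j jk.
  have -> : j = 0%N by rewrite expn0 in jk; lia.
  by rewrite /= subr0 cantor_length00.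
have jk2 : (j./2 < 2 ^ k)%N by rewrite expnS in jk; lia.
have := IH _ jk2; rewrite (cantor_length_split jk2) /=.
case: (cantor_ends a k j./2) => x y /= xy.
case: ifPn => jo /=.
  have -> : (cantor_length a k.+1 j) = cantor_length a k.+1 j./2.*2.+1
    by congr cantor_length; lia.
  lra.
have -> : (cantor_length a k.+1 j) = cantor_length a k.+1 j./2.*2
  by congr cantor_length; lia.
lra.
Qed.

End CantorLengths.

(* Main.v *)
Require Import Defs.
From HB Require Import structures.
From mathcomp Require Import all_boot all_order all_algebra.
From mathcomp Require Import all_classical all_reals all_analysis.
From mathcomp Require Import zify ring lra.
Import Order.TTheory GRing.Theory Num.Theory.
Import numFieldNormedType.Exports.
Local Open Scope classical_set_scope.
Local Open Scope ring_scope.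

(** Let t_k be the sum of the gaps that survive the removal of the 2^k - 1
    largest ones, and s_k = t_k / 2^k ([mean_length a k]), the average length
    of the 2^k intervals of step k in the construction of the Cantor set.  The
    point is that s_k is a universal scale: every complementary set of [a] needs
    about 2^k balls of radius s_k, whatever the order of its gaps.

    - At least 2^k / 6 balls of radius 3 s_k are needed.  A gap that n balls
      fail to swallow has a right endpoint, in E, covered by a ball of its own;
      so all but n gaps are swallowed, and t_k is at most the total length of
      the balls if n < 2^k ([complementary_cover_le]).
    - At most 2^(k+1) points of E are pairwise s_k apart.  The open intervals
      ]y, y + s_k[ starting at such points y are disjoint; at most one of them
      meets a given large gap, and those that meet no large gap have total
      length at most t_k + s_k ([complementary_separated_card]).

    If alpha is admissible in the definition of the lower dimension of E, one
    puts about (s_k / s_m)^alpha points at distance s_m of each other around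
    each of 2^k / 6 points of E at distance 3 s_k of each other.  Counting them
    gives (s_k / s_m)^alpha <= C 2^(m-k), a relation between numbers that depend
    on [a] only ([complementary_dim_growth]).

    In the Cantor set all this is homogeneous: as [a] decreases, each interval
    of step k has length between s_(k+1) and s_(k-1).  Hence a ball of radius
    about s_k centred in the Cantor set contains an interval of step about k,
    whose descendants of step about m have 2^(m-k) left endpoints, all in the
    Cantor set and too far apart for a ball of radius about s_m to contain two
    of them ([cantor_cover_ge]).  By the relation
    above this number dominates (s_k / s_m)^alpha, up to a constant, so alpha is
    admissible for the Cantor set as well. *)

(** * Lengths of families of intervals *)

(** Additivity and subadditivity of the Lebesgue measure; this is the only use of
    measure theory. *)
Lemma sum_disjoint_itv_le (R : realType) (I K : finType) (P : pred I)
    (x y : I -> R) (u v : K -> R) :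
  (forall i, P i -> x i <= y i) -> (forall k, u k <= v k) ->
  trivIset [set` P] (fun i => `]x i, y i[%classic) ->
  (forall i, P i -> `]x i, y i[%classic `<=` \bigcup_k `[u k, v k]%classic) ->
  \sum_(i | P i) (y i - x i) <= \sum_k (v k - u k).
Proof.
move=> xy uv dis sub; rewrite -lee_fin -!sumEFin.
pose mu : {measure set (measurableTypeR R) -> \bar R} := @lebesgue_measure R.
have mui : (\sum_(i | P i) (y i - x i)%:E = \sum_(i | P i) mu `]x i, y i[%classic)%E.
  apply: eq_bigr => i /xy H; symmetry; apply: etrans (lebesgue_measure_itv _) _.
  move: H; rewrite /= lte_fin le_eqVlt.
  by case/orP => [/eqP->|->]; rewrite ?ltxx ?subrr ?EFinB.
have muk : (\sum_k (v k - u k)%:E = \sum_k mu `[u k, v k]%classic)%E.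
  apply: eq_bigr => k _; symmetry; apply: etrans (lebesgue_measure_itv _) _.
  by move: (uv k); rewrite /= lte_fin le_eqVlt => /orP[/eqP->|->]; rewrite ?ltxx ?subrr ?EFinB.
pose U (k : K) : set (measurableTypeR R) := `[u k, v k]%classic.
pose V (i : I) : set (measurableTypeR R) := `]x i, y i[%classic.
have mU k : measurable (U k) by exact: measurable_itv.
have mV i : measurable (V i) by exact: measurable_itv.
rewrite mui muk.
(* Both sums are compared with the measure of the union of the closed intervals *)
apply: (@le_trans _ _ (mu (\big[setU/set0]_k U k))); last first.
  suff: measurable (\big[setU/set0]_k U k) /\
     (mu (\big[setU/set0]_k U k) <= \sum_k mu (U k))%E by case.
  apply: (@big_rec2 _ _ (fun A s => measurable A /\ (mu A <= s)%E)).
    by rewrite measure0.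
  move=> k s A _ [mA As]; split; first exact: measurableU.
  by apply: (le_trans (measureU2 mu (mU k) mA)); rewrite leeD2l.
rewrite -[leLHS]big_filter fsbig_seq ?filter_uniq ?index_enum_uniq//.
set D := [set` _].
have PD i : D i -> P i by rewrite /D /= mem_filter => /andP[].
rewrite -(@measure_fin_bigcup _ _ _ mu _ D V) //; last 2 first.
- exact: finite_finset.
- by move=> i j /PD Pi /PD Pj; apply: dis.
apply: le_measure; rewrite ?inE.
- by apply: fin_bigcup_measurable => //; exact: finite_finset.
- by apply: bigsetU_measurable.
move=> t [i /PD /sub Ui /Ui[k _ kt]].
by rewrite -(bigcup_pred xpredT U); exists k.
Qed.

(** By induction on [m]: a new term with index [m] comes after at most [m] terms
    selected before it, hence is at most the next term of the series. *)
Lemma sum_le_series_count (R : realType) (a : R^nat) (Q : pred nat) n m :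
  (forall j, 0 < a j) -> (forall j, a j.+1 <= a j) ->
  (count Q (iota 0 m) <= n)%N ->
  \sum_(0 <= j < m | Q j) a j <= series a n.
Proof.
move=> a0 ad cn.
have an : {homo a : i j / (i <= j)%N >-> j <= i} by exact/nonincreasing_seqP.
apply: (@le_trans _ _ (series a (count Q (iota 0 m)))); last first.
  by apply: nondecreasing_series => // i _ _; exact/ltW/a0.
elim: m {cn} => [|m IH]; first by rewrite /series /= !big_nil.
have -> : count Q (iota 0 m.+1) = (count Q (iota 0 m) + Q m)%N.
  by rewrite -addn1 iotaD count_cat /= addn0 add0n.
rewrite big_mkcond big_nat_recr //= -big_mkcond /=.
case: (Q m) => /=; last by rewrite addr0 addn0.
rewrite addn1 seriesSr lerD // an //.
by rewrite -[leqRHS](size_iota 0) count_size.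
Qed.

(** * Balls and separated points *)

Lemma closed_ball_itv (R : realType) (c r : R) : 0 < r ->
  closed_ball c r = `[c - r, c + r]%classic.
Proof.
move=> r0; rewrite closed_ballE //; apply/seteqP; split => t;
  by rewrite /closed_ball_ /= in_itv /= distrC ler_distl.
Qed.

Lemma le_covering_numberP (R : realType) (r K : R) (F : set R) :
  (K%:E <= covering_number r F)%E <->
  forall n (c : 'I_n -> R), F `<=` \bigcup_i closed_ball (c i) r -> K <= n%:R.
Proof.
split=> [KF n c Fc|H].
  by rewrite -lee_fin; apply: le_trans KF _; apply: ereal_inf_lbound; exists n => //; exists c.
by apply: le_ereal_inf_tmp => _ [n [c Fc] <-]; rewrite lee_fin; exact: H Fc.
Qed.

(** The greedy choice: as long as fewer than [N] points are chosen, the balls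
    around them do not cover [F], and a point of [F] outside can be added. *)
Lemma exists_separated (R : realType) (F : set R) (r : R) N : 0 < r ->
  (forall n (c : 'I_n -> R), F `<=` \bigcup_i closed_ball (c i) r ->
     (N <= n)%N) ->
  exists x : 'I_N -> R, (forall i, F (x i)) /\
    (forall i j, i != j -> r < `|x i - x j|).
Proof.
move=> r0 hN.
suff [s [sN sF sr]] : exists s : seq R, [/\ size s = N, forall t, t \in s -> F t
    & pairwise (fun x y => r < `|x - y|) s].
  exists (fun i : 'I_N => nth 0 s i); split=> [i|].
    by apply/sF/mem_nth; rewrite sN.
  move/(pairwiseP 0) : sr => sr i j; rewrite neq_ltn => /orP[ij|ji].
    by apply: sr => //; rewrite inE sN.
  by rewrite distrC; apply: sr => //; rewrite inE sN.
suff: forall M, (M <= N)%N -> exists s : seq R, [/\ size s = M,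
    forall t, t \in s -> F t & pairwise (fun x y => r < `|x - y|) s].
  exact.
elim=> [_|M IH MN]; first by exists [::].
have [s [sM sF sr]] := IH (ltnW MN).
have [p [Fp ps]] : exists p, F p /\ forall t, t \in s -> r < `|p - t|.
  apply: contrapT => nop.
  suff: (N <= M)%N by rewrite leqNgt MN.
  apply: (hN M (fun i => nth 0 s i)) => t Ft.
  apply: contrapT => nt; apply: nop; exists t; split=> // q /(nthP 0)[i iM <-].
  rewrite ltNge; apply/negP => le; apply: nt.
  rewrite sM in iM; exists (Ordinal iM) => //=.
  by rewrite closed_ballE // /closed_ball_ /= distrC.
exists (p :: s); split => /=; first by rewrite sM.
  by move=> t; rewrite inE => /orP[/eqP->|/sF].
by rewrite sr andbT; apply/allP => t /ps.
Qed.

(** * Counting balls and points in a complementary set *)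

(** The combinatorial content of being a complementary set: disjointness of two
    gaps becomes the fact that one of them lies to the left of the other. *)
Lemma complementary_set_gaps {R : realType} {a : R^nat} {E : set R} :
  (forall j, 0 < a j) -> complementary_set a E ->
  exists l u : R^nat,
    [/\ forall j, u j - l j = a j,
        forall j, 0 <= l j /\ u j <= total_length a,
        forall i j, i != j -> u i <= l j \/ u j <= l i
      & forall t, E t <->
          (0 <= t <= total_length a) /\ forall j, ~~ (l j < t < u j)].
Proof.
move=> a0 [U [/choice[l /choice[u lu]] UL tU ->]].
have Ulu j : U j = `]l j, u j[%classic by case: (lu j).
have lua j : u j - l j = a j by case: (lu j).
have luj j : l j < u j by rewrite -subr_gt0 lua.
exists l, u; split=> //.
- move=> j; have := UL j; rewrite Ulu => sub; split; rewrite leNgt; apply/negP.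
  + move=> l0; have : 0 <= Num.min 0 (u j) / 2 + l j / 2 <= total_length a.
      apply: (sub (Num.min 0 (u j) / 2 + l j / 2)); rewrite /= in_itv /=.
      by have := luj j; case: (leP 0 (u j)) => *; apply/andP; split; lra.
    by have := luj j; case: (leP 0 (u j)) => *; lra.
  + move=> l0; have : 0 <= Num.max (total_length a) (l j) / 2 + u j / 2 <= total_length a.
      apply: (sub (Num.max (total_length a) (l j) / 2 + u j / 2)); rewrite /= in_itv /=.
      by have := luj j; case: (leP (total_length a) (l j)) => *; apply/andP; split; lra.
    by have := luj j; case: (leP (total_length a) (l j)) => *; lra.
- move=> i j ij; apply: contrapT => /not_orP[/negP + /negP].
  rewrite -!ltNge => ji ij'; case/eqP: ij; apply: tU => //.
  exists (Num.max (l i) (l j) / 2 + Num.min (u i) (u j) / 2); rewrite !Ulu /= !in_itv /=.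
  by have := luj i; have := luj j; case: (leP (l i) (l j)); case: (leP (u i) (u j)) => *;
    split; apply/andP; split; lra.
- move=> t; rewrite /setD /= in_itv /=; split=> -[t0 tU']; split=> //.
    by move=> j; apply/negP => tj; apply: tU'; exists j => //; rewrite Ulu /= in_itv.
  by move=> [j _]; rewrite Ulu /= in_itv /= => tj; move/negP: (tU' j).
Qed.

Section ComplementarySets.
Variables (R : realType) (a : R^nat) (E : set R).
Hypotheses (a_pos : forall j, 0 < a j) (a_summable : cvgn (series a)).
Hypotheses (a_decreasing : forall j, a j.+1 <= a j).
Hypothesis (hE : complementary_set a E).
Let L := total_length a.

(** The balls that contain the right endpoints of two different gaps not covered
    by the balls are different: a ball containing both endpoints would contain the
    gap on the right entirely.  So at most [n] gaps are not covered; their total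
    length is at most [series a n], and the others fit in the balls. *)
Lemma complementary_cover_le n (c : 'I_n -> R) (r : R) : 0 < r ->
  E `<=` \bigcup_i closed_ball (c i) r ->
  L - series a n <= 2 * r * n%:R.
Proof.
move=> r0 Ec.
have [l [u [lua lu0 ludis EP]]] := complementary_set_gaps a_pos hE.
have luj j : l j < u j by rewrite -subr_gt0 lua.
have Eu j : E (u j).
  apply/EP; split=> [|i]; first by have := luj j; have := lu0 j => -[]; lra.
  have [->|ij] := eqVneq i j; first by rewrite ltxx andbF.
  by apply/negP => /andP[h1 h2]; have := luj i; have := luj j; case: (ludis _ _ ij); lra.
have /choice[f fu] : forall j, exists i : 'I_n, `[c i - r, c i + r]%classic (u j).
  by move=> j; have [i _ iu] := Ec _ (Eu j); exists i; rewrite -closed_ball_itv.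
pose bad j := ~~ `[< `]l j, u j[%classic `<=` \bigcup_i closed_ball (c i) r >].
have bad_count M : (count bad (iota 0 M) <= n)%N.
  rewrite -size_filter -(size_map f) -[leqRHS]card_ord.
  rewrite -(card_uniqP _) ?max_card // map_inj_in_uniq ?filter_uniq ?iota_uniq //.
  move=> i j; rewrite !mem_filter => /andP[bi _] /andP[bj _] fij.
  suff main i' j' : bad j' -> f i' = f j' -> u i' <= l j' -> False.
    apply/eqP; apply: contrapT => /negP ij.
    case: (ludis _ _ ij); first exact: main.
    by apply: main => //; rewrite fij.
  move=> /asboolP + fij' uij; apply=> t /=; rewrite in_itv /= => /andP[lt tu].
  exists (f j') => //; rewrite closed_ball_itv //=.
  have := fu i'; have := fu j'; rewrite fij' /= !in_itv /=.
  by move=> /andP[h1 h2] /andP[h3 h4]; apply/andP; split; lra.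
suff bound M : series a M <= series a n + 2 * r * n%:R.
  rewrite lerBlDl; apply: limr_le => //; exact: nearW.
rewrite /series /= (bigID bad) /= lerD //.
  exact: sum_le_series_count.
rewrite big_mkord.
have -> : 2 * r * n%:R = \sum_(i < n) ((c i + r) - (c i - r)).
  rewrite (eq_bigr (fun=> 2 * r)); last by move=> i _; ring.
  by rewrite sumr_const card_ord mulr_natr.
rewrite (eq_bigr (fun j : 'I_M => u j - l j)); last by move=> j _; rewrite lua.
apply: sum_disjoint_itv_le.
- by move=> j _; exact/ltW.
- by move=> k; lra.
- move=> i j _ _ [t [/=]]; rewrite !in_itv /= => /andP[h1 h2] /andP[h3 h4].
  apply/eqP; apply: contrapT => /negP ij.
  by case: (ludis i j ij); lra.
- move=> j; rewrite negbK => /asboolP sub t /sub[i _]; rewrite closed_ball_itv //.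
  by exists i.
Qed.

(** The [K] largest gaps and the intervals ]y, y + r[ that meet none of them are
    disjoint and fit in [0, L + r].  Since no [y i] lies in a gap, an interval
    ]y, y + r[ that meets a gap contains its left endpoint (or starts there); as
    the [y i] are [r] apart, at most [K] of the intervals meet a large gap. *)
Lemma complementary_separated_card (T : finType) (y : T -> R) (r : R) K :
  0 < r -> (forall i, E (y i)) -> (forall i j, i != j -> r <= `|y i - y j|) ->
  #|T|%:R * r <= K%:R * r + (L - series a K) + r.
Proof.
move=> r0 Ey ysep.
have [l [u [lua lu0 ludis EP]]] := complementary_set_gaps a_pos hE.
have luj j : l j < u j by rewrite -subr_gt0 lua.
(* The interval ]y i, y i + r[ meets one of the K largest gaps. *)
pose hit i := [exists j : 'I_K, (y i < u j) && (l j < y i + r)].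
have hitl i j : y i < u j -> y i <= l j.
  by move=> yu; have [_ /(_ j)] := (EP _).1 (Ey i); rewrite yu andbT -leNgt.
have hitK : (#|hit| <= K)%N.
  case: (K =P 0)%N => [K0|/eqP K0].
    rewrite eq_card0 // => i; apply/negbTE/existsP => -[[j jK]] _.
    by move: (jK); rewrite K0.
  have j0 : 'I_K by exists 0%N; rewrite lt0n.
  have /choice[f fP] : forall i, exists j : 'I_K, hit i -> (y i < u j) && (l j < y i + r).
    by move=> i; case: (boolP (hit i)) => [/existsP[j hj]|_]; [exists j|exists j0].
  rewrite -[leqRHS]card_ord; apply: (@leq_card_in _ _ f) => i j.
  move=> /fP/andP[/hitl h1 h2] /fP/andP[/hitl h3 h4] fij.
  apply/eqP; apply: contrapT => /negP /ysep.
  by rewrite fij in h1 h2; rewrite leNgt ltr_norml => /negP[]; apply/andP; split; lra.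
pose P (i : T + 'I_K) := if i is inl i then ~~ hit i else true.
pose x (i : T + 'I_K) := match i with inl i => y i | inr j => l j end.
pose z (i : T + 'I_K) := match i with inl i => y i + r | inr j => u j end.
have Eb i : 0 <= y i <= L by have [] := (EP _).1 (Ey i).
have : \sum_(i | P i) (z i - x i) <= \sum_(i < 1) ((L + r) - 0).
  apply: sum_disjoint_itv_le.
  - by case=> i _ /=; [lra|exact: ltW].
  - by move=> _; move: (lu0 0%N) (luj 0%N) => -[]; rewrite -/L; lra.
  - case=> [i|i] [j|j] Pi Pj [t [/=]]; rewrite !in_itv /= => /andP[h1 h2] /andP[h3 h4].
    + congr inl; apply/eqP; apply: contrapT => /negP /ysep.
      by rewrite leNgt ltr_norml => /negP[]; apply/andP; split; lra.
    + by case/negP: Pi; apply/existsP; exists j; apply/andP; split; lra.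
    + by case/negP: Pj; apply/existsP; exists i; apply/andP; split; lra.
    + congr inr; apply/eqP; apply: contrapT => /negP ij.
      by case: (ludis i j ij); lra.
  - move=> i _ t /=; rewrite in_itv /= => h; exists ord0 => //=; rewrite in_itv /=.
    case: i h => i /= /andP[h1 h2].
      by have /andP[h3 h4] := Eb i; apply/andP; split; lra.
    by have [h3 h4] := lu0 i; apply/andP; split; move: h4; rewrite -/L; lra.
rewrite big_ord1 subr0 big_sumType /=.
rewrite (eq_bigr (fun=> r)); last by move=> i _; ring.
rewrite [X in _ + X](eq_bigr (fun j : 'I_K => a j)); last by move=> j _; rewrite lua.
rewrite sumr_const -[_ *+ _]mulr_natl -(big_mkord xpredT) -[\sum_(_ <= _ < _) _]/(series a K).
have -> : #|T|%:R = #|hit|%:R + #|fun i => ~~ hit i|%:R :> R.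
  by rewrite -natrD -(cardC hit).
rewrite mulrDl.
have : #|hit|%:R * r <= K%:R * r by rewrite ler_pM2r // ler_nat.
lra.
Qed.
End ComplementarySets.

(** * Mean lengths and lengths of the Cantor intervals *)

(** The numerator is the sum of all gaps removed at step [k] or later, because
    2^k - 1 gaps are removed before. *)
Definition mean_length {R : realType} (a : R^nat) k : R :=
  (total_length a - series a (2 ^ k).-1) / 2 ^+ k.

Section MeanLengths.
Variables (R : realType) (a : R^nat).
Hypotheses (a_pos : forall j, 0 < a j) (a_summable : cvgn (series a)).
Hypotheses (a_decreasing : forall j, a j.+1 <= a j).

Lemma series_le_total n : series a n <= total_length a.
Proof.
apply: nondecreasing_cvgn_le => //.
by apply: nondecreasing_series => i _ _; exact/ltW/a_pos.
Qed.

Lemma mean_length_gt0 k : 0 < mean_length a k.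
Proof.
rewrite divr_gt0 ?exprn_gt0 // subr_gt0.
apply: lt_le_trans (series_le_total (2 ^ k).-1.+1).
by rewrite seriesSr ltrDl.
Qed.

Lemma mean_lengthS_le k : mean_length a k.+1 <= mean_length a k / 2.
Proof.
rewrite /mean_length -mulrA -invfM -exprSr ler_pM2r ?invr_gt0 ?exprn_gt0 //.
rewrite lerB //; apply: nondecreasing_series => [i _ _|]; first exact/ltW/a_pos.
by rewrite expnS; lia.
Qed.

Lemma mean_lengthD_le k n : mean_length a (k + n) <= mean_length a k / 2 ^+ n.
Proof.
elim: n => [|n IH]; first by rewrite addn0 divr1.
rewrite addnS exprSr invfM mulrA; apply: le_trans (mean_lengthS_le _) _.
by rewrite ler_pM2r.
Qed.

Lemma mean_length_anti k m : (k <= m)%N -> mean_length a m <= mean_length a k.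
Proof.
move=> km; rewrite -(subnKC km); apply: le_trans (mean_lengthD_le _ _) _.
rewrite ler_pdivrMr ?exprn_gt0 // ler_peMr ?(ltW (mean_length_gt0 k)) //.
by rewrite exprn_ege1 // ler1n.
Qed.

Lemma mean_length_lt (e : R) : 0 < e -> exists k, mean_length a k < e.
Proof.
move=> e0; exists (Num.bound (mean_length a 0 / e)).
apply: le_lt_trans (mean_lengthD_le 0 _) _.
rewrite ltr_pdivrMr ?exprn_gt0 // mulrC -ltr_pdivrMr //.
exact: upper_nthrootP.
Qed.

(** The gaps of step [k + i] are terms of [a] whose indices run from 2^(k+i) - 1
    to 2^(k+i+1) - 2. *)
Lemma cantor_block_bounds k j i : (j < 2 ^ k)%N ->
  2 ^+ i * a (2 ^ (k.+1 + i)).-1 <= cantor_block a k j i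
    <= 2 ^+ i * a (2 ^ (k + i)).-1.
Proof.
move=> jk.
have an : {homo a : i j / (i <= j)%N >-> j <= i} by exact/nonincreasing_seqP.
have const (x : R) : 2 ^+ i * x = \sum_(m < 2 ^ i) x.
  by rewrite sumr_const card_ord -[RHS]mulr_natl natrX.
have lt (m : 'I_(2 ^ i)) : (j * 2 ^ i + m < 2 ^ (k + i))%N.
  rewrite expnD; apply: (@leq_trans (j.+1 * 2 ^ i)); last by rewrite leq_mul2r jk orbT.
  by rewrite mulSn addnC ltn_add2r.
rewrite !const; apply/andP; split; apply: ler_sum => m _; apply: an.
  by have := lt m; rewrite addSn expnS; lia.
by have := lt m; lia.
Qed.

(** The block [cantor_block a 0 0 (k + i)] collects all gaps of step [k + i], so this
    spreads the gaps evenly over the 2^k intervals of step [k]; the series can then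
    be compared with [cantor_length] step by step. *)
Lemma cvg_mean_length k :
  (fun n => \sum_(0 <= i < n) cantor_block a 0 0 (k + i) / 2 ^+ k) @ \oo -->
    mean_length a k.
Proof.
have -> : (fun n => \sum_(0 <= i < n) cantor_block a 0 0 (k + i) / 2 ^+ k) =
    (fun n => (series (cantor_block a 0 0) (n + k)%N - series a (2 ^ k).-1) / 2 ^+ k).
  apply/funext => n; rewrite -series_cantor_block0 -mulr_suml; congr (_ / _).
  rewrite sub_series_geq ?leq_addl // -{2}[k]add0n big_addn addnK.
  by apply: eq_bigr => i _; rewrite addnC.
apply: cvgM; last exact: cvg_cst.
apply: cvgB; last exact: cvg_cst.
by rewrite cvg_shiftn; exact: cvg_cantor_block0.
Qed.

(** Every gap removed at step [k + i] is at least as large as every gap of step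
    [k + 1 + i]. *)
Lemma mean_length_le_cantor k j : (j < 2 ^ k)%N ->
  mean_length a k.+1 <= cantor_length a k j.
Proof.
move=> jk; rewrite -(cvg_lim (@Rhausdorff R) (cvg_mean_length k.+1)).
apply: ler_lim.
- by apply/cvg_ex; exists (mean_length a k.+1); exact: cvg_mean_length.
- exact: cvg_cantor_block.
apply: nearW => n; rewrite /series /=; apply: ler_sum => i _.
have /andP[+ _] := cantor_block_bounds k j i jk; apply: le_trans.
have /andP[_] := cantor_block_bounds 0 0 (k.+1 + i) isT.
by rewrite ler_pdivrMr ?exprn_gt0 // mulrAC -exprD addnC.
Qed.

(** Every gap removed at step [k + 1 + i] is at most as large as every gap of step
    [k + i]. *)
Lemma cantor_le_mean_length k j : (j < 2 ^ k.+1)%N ->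
  cantor_length a k.+1 j <= mean_length a k.
Proof.
move=> jk; rewrite -(cvg_lim (@Rhausdorff R) (cvg_mean_length k)).
apply: ler_lim.
- exact: cvg_cantor_block.
- by apply/cvg_ex; exists (mean_length a k); exact: cvg_mean_length.
apply: nearW => n; rewrite /series /=; apply: ler_sum => i _.
have /andP[_] := cantor_block_bounds k.+1 j i jk; move/le_trans; apply.
have /andP[+ _] := cantor_block_bounds 0 0 (k + i) isT.
by rewrite ler_pdivlMr ?exprn_gt0 // mulrAC -exprD [(i + k)%N]addnC !add1n addSn.
Qed.

End MeanLengths.

(** * Covering the Cantor set *)

Section CantorSet.
Variables (R : realType) (a : R^nat).
Hypotheses (a_pos : forall j, 0 < a j) (a_summable : cvgn (series a)).
Hypotheses (a_decreasing : forall j, a j.+1 <= a j).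

Notation lo k j := (cantor_ends a k j).1.
Notation hi k j := (cantor_ends a k j).2.

Lemma cantor_length_gt0 k j : (j < 2 ^ k)%N -> 0 < cantor_length a k j.
Proof.
move=> jk; apply: lt_le_trans (mean_length_le_cantor _ _ _ _ _ k j jk) => //.
exact: mean_length_gt0.
Qed.

Lemma cantor_ends_even k j :
  cantor_ends a k.+1 j.*2 = (lo k j, lo k j + cantor_length a k.+1 j.*2).
Proof. by rewrite /= doubleK odd_double; case: cantor_ends. Qed.

Lemma cantor_ends_odd k j :
  cantor_ends a k.+1 j.*2.+1 =
  (lo k j + cantor_length a k.+1 j.*2 + cantor_gap a k j, hi k j).
Proof. by rewrite /= uphalf_double odd_double; case: cantor_ends. Qed.

Local Arguments cantor_ends : simpl never.

Lemma cantor_hi k j : (j < 2 ^ k)%N -> hi k j = lo k j + cantor_length a k j.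
Proof. by move=> jk; rewrite -cantor_ends_length //; ring. Qed.

Lemma cantor_child k j : (j < 2 ^ k.+1)%N ->
  lo k j./2 <= lo k.+1 j /\ hi k.+1 j <= hi k j./2.
Proof.
move=> jk; have jk2 : (j./2 < 2 ^ k)%N by rewrite expnS in jk; lia.
have g0 : 0 < cantor_gap a k j./2 by exact: a_pos.
have l1 : 0 < cantor_length a k.+1 j./2.*2.
  by apply: cantor_length_gt0; rewrite expnS; lia.
have l2 : 0 < cantor_length a k.+1 j./2.*2.+1.
  by apply: cantor_length_gt0; rewrite expnS; lia.
have := cantor_length_split a_pos a_summable jk2.
have [->|->] : (j = j./2.*2 \/ j = j./2.*2.+1)%N by lia.
  by rewrite cantor_ends_even doubleK (cantor_hi k) //= => ->; split; lra.
by rewrite cantor_ends_odd /= uphalf_double; split; lra.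
Qed.

Lemma cantor_descendant k j n m : (j < 2 ^ k)%N -> (m < 2 ^ n)%N ->
  lo k j <= lo (k + n) (j * 2 ^ n + m) /\ hi (k + n) (j * 2 ^ n + m) <= hi k j.
Proof.
move=> jk; elim: n m => [|n IH] m mn.
  have -> : m = 0%N by rewrite expn0 in mn; lia.
  by rewrite expn0 !addn0 muln1.
have mn2 : (m./2 < 2 ^ n)%N by rewrite expnS in mn; lia.
have [lo1 hi1] := IH _ mn2.
have -> : (k + n.+1 = (k + n).+1)%N by lia.
have half : ((j * 2 ^ n.+1 + m)./2 = j * 2 ^ n + m./2)%N.
  by rewrite expnS mulnCA mul2n halfD odd_double /= doubleK.
have [] := @cantor_child (k + n) (j * 2 ^ n.+1 + m).
  have : (j.+1 * 2 ^ n.+1 <= 2 ^ k * 2 ^ n.+1)%N by rewrite leq_mul2r jk orbT.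
  by rewrite -(addnS k n) expnD mulSn; lia.
by rewrite half; split; lra.
Qed.

Lemma cantor_hi_le_lo k i j : (i < j)%N -> (j < 2 ^ k)%N -> hi k i <= lo k j.
Proof.
elim: k i j => [|k IH] i j ij jk; first by rewrite expn0 in jk; lia.
have jk2 : (j./2 < 2 ^ k)%N by rewrite expnS in jk; lia.
have ik : (i < 2 ^ k.+1)%N by lia.
have [ij2|ij2] := ltnP i./2 j./2.
  have [_ h1] := cantor_child k i ik; have [h2 _] := cantor_child k j jk.
  by have := IH _ _ ij2 jk2; lra.
have [-> ->] : (i = j./2.*2 /\ j = j./2.*2.+1)%N by lia.
rewrite cantor_ends_even cantor_ends_odd /= uphalf_double lerDl.
exact/ltW/a_pos.
Qed.

Lemma cantor_lo_separated k i j : (i < 2 ^ k)%N -> (j < 2 ^ k)%N -> i != j ->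
  mean_length a k.+1 <= `|lo k i - lo k j|.
Proof.
wlog ij : i j / (i < j)%N => [hw|] ik jk.
  rewrite neq_ltn => /orP[ij|ij]; first by apply: hw; rewrite // neq_ltn ij.
  by rewrite distrC; apply: hw; rewrite // neq_ltn ij.
move=> _; rewrite distrC; apply: le_trans (ler_norm _).
have := cantor_hi_le_lo k i j ij jk; rewrite cantor_hi //.
have := mean_length_le_cantor R a a_pos a_summable a_decreasing k i ik.
lra.
Qed.

Lemma cantor_lo_leftmost k j n : lo (k + n) (j * 2 ^ n) = lo k j.
Proof.
elim: n => [|n IH]; first by rewrite addn0 muln1.
by rewrite addnS expnS mulnCA mul2n cantor_ends_even.
Qed.

(** A left endpoint is the left endpoint of a descendant at each later step, and
    belongs to the ancestors at the earlier ones. *)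
Lemma cantor_set_lo k j : (j < 2 ^ k)%N -> cantor_set a (lo k j).
Proof.
move=> jk k' _.
have lohi i p : (i < 2 ^ p)%N -> lo p i <= hi p i.
  by move=> ip; rewrite cantor_hi // lerDl ltW // cantor_length_gt0.
have [kk|kk] := leqP k k'.
  rewrite -(subnKC kk); exists (j * 2 ^ (k' - k))%N => /=.
    by rewrite expnD ltn_pmul2r ?expn_gt0.
  have le := lohi (j * 2 ^ (k' - k))%N (k + (k' - k))%N.
  rewrite /cantor_interval /= in_itv /= -[lo k j](cantor_lo_leftmost k j (k' - k)).
  by rewrite lexx le // expnD ltn_pmul2r ?expn_gt0.
pose n := (k - k')%N; have kE : k = (k' + n)%N by rewrite /n; lia.
exists (j %/ 2 ^ n)%N => /=; first by rewrite ltn_divLR ?expn_gt0 // -expnD -kE.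
have jn : (j %/ 2 ^ n < 2 ^ k')%N by rewrite ltn_divLR ?expn_gt0 // -expnD -kE.
have := cantor_descendant k' (j %/ 2 ^ n) n (j %% 2 ^ n) jn.
rewrite -divn_eq -kE ltn_mod expn_gt0 => /(_ isT) [h1 h2].
rewrite /cantor_interval /= in_itv /= h1 /=.
by apply: le_trans h2; exact: lohi.
Qed.

(** The interval of step [q + 1] that contains [x] has length at most
    [mean_length a q], hence is inside the ball of radius [s].  The left endpoints of
    its 2^n descendants at step [q + 1 + n] are too far apart for two of them to be
    in one ball of radius [r]. *)
Lemma cantor_cover_ge x s r q n N (c : 'I_N -> R) : 0 < r -> 0 < s ->
  cantor_set a x -> mean_length a q <= s ->
  2 * r < mean_length a (q.+1 + n).+1 ->
  closed_ball x s `&` cantor_set a `<=` \bigcup_i closed_ball (c i) r ->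
  (2 ^ n <= N)%N.
Proof.
move=> r0 s0 Cx qs rn cov.
have [j /= jq] := Cx q.+1 isT; rewrite /cantor_interval /= in_itv /= => /andP[xlo xhi].
pose p (m : 'I_(2 ^ n)) := (j * 2 ^ n + m)%N.
have pn m : (p m < 2 ^ (q.+1 + n))%N.
  have : (j.+1 * 2 ^ n <= 2 ^ q.+1 * 2 ^ n)%N by rewrite leq_mul2r jq orbT.
  by rewrite expnD mulSn /p; have := ltn_ord m; lia.
have /choice[f fP] : forall m, exists i : 'I_N,
    c i - r <= lo (q.+1 + n) (p m) <= c i + r.
  move=> m; have [|i _] := cov (lo (q.+1 + n) (p m)); last first.
    by rewrite closed_ball_itv //= in_itv /=; exists i.
  split; last exact/cantor_set_lo.
  rewrite closed_ball_itv //= in_itv /=.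
  have [h1 h2] := cantor_descendant q.+1 j n m jq (ltn_ord m).
  have := cantor_le_mean_length R a a_pos a_summable a_decreasing q j jq.
  have := cantor_length_gt0 (q.+1 + n) (p m) (pn m).
  move: xhi h1 h2; rewrite -/(p m) !cantor_hi //.
  by move=> *; apply/andP; split; lra.
rewrite -[leqLHS]card_ord -[leqRHS]card_ord; apply: (leq_card f) => m m' fm.
apply/eqP; apply: contrapT => /negP mm.
have pp : p m != p m' by rewrite /p eqn_add2l.
have := cantor_lo_separated (q.+1 + n) (p m) (p m') (pn m) (pn m') pp.
have := fP m; have := fP m'; rewrite fm => /andP[h1 h2] /andP[h3 h4].
by rewrite leNgt ltr_norml => /negP[]; apply/andP; split; lra.
Qed.

End CantorSet.

(** * Comparison of the dimensions *)

(** Around each of [N] points of [E] at distance > 3 s of each other, choose [M]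
    points of [E] within distance [s] and at distance > r of each other.  The [N * M]
    points so obtained are still [r]-separated, as 3 s - 2 s >= r; for
    [r = mean_length a m] there are at most 2 * 2^m of them. *)
Lemma complementary_dim_growth (R : realType) (a : R^nat) (E : set R)
    (alpha c rho : R) k m :
  (forall j, 0 < a j) -> cvgn (series a) -> (forall j, a j.+1 <= a j) ->
  complementary_set a E -> 0 < c ->
  (forall r s : R, 0 < r -> r < s -> s < rho -> forall x, E x ->
     ((c * (s / r) `^ alpha)%:E <= covering_number r (closed_ball x s `&` E))%E) ->
  (k < m)%N -> mean_length a k < rho ->
  c * (mean_length a k / mean_length a m) `^ alpha * 2 ^+ k <= 12 * 2 ^+ m.
Proof.
move=> a0 ca ad hE c0 dimE km krho.
have mean0 i : 0 < mean_length a i by exact: mean_length_gt0.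
set s := mean_length a k in krho *; set r := mean_length a m.
have s0 : 0 < s := mean0 k; have r0 : 0 < r := mean0 m.
have rs : r < s.
  apply: (@le_lt_trans _ _ (s / 2)); last by rewrite ltr_pdivrMr // ltr_pMr // ltr1n.
  apply: le_trans (mean_lengthS_le R a a0 k).
  exact: mean_length_anti.
have tail i : total_length a - series a (2 ^ i).-1 = 2 ^+ i * mean_length a i.
  by rewrite /mean_length mulrC divfK // expf_neq0.
(* The integer ceiling of 2^k / 6. *)
pose N := ((2 ^ k + 5) %/ 6)%N.
have [X [XE Xsep]] : exists X : 'I_N -> R, (forall i, E (X i)) /\
    (forall i j, i != j -> 3 * s < `|X i - X j|).
  apply: exists_separated => [|n b Eb]; first by rewrite mulr_gt0.
  suff : (2 ^ k <= 6 * n)%N by rewrite /N; lia.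
  have := complementary_cover_le R a E a0 ca ad hE n b (3 * s) _ Eb.
  rewrite mulr_gt0 // => /(_ isT) cov.
  have [nk|nk] := leqP (2 ^ k) n; first by lia.
  have : series a n <= series a (2 ^ k).-1.
    apply: nondecreasing_series => [i _ _|]; first exact/ltW/a0.
    by lia.
  rewrite -(ler_nat R) natrM natrX => nk'.
  rewrite -(ler_pM2r s0); have := tail k; rewrite -/s; lra.
pose M := `|Num.ceil (c * (s / r) `^ alpha)|%N.
have cpow0 : 0 <= c * (s / r) `^ alpha by rewrite mulr_ge0 ?powR_ge0 // ltW.
have ceil0 : 0 <= Num.ceil (c * (s / r) `^ alpha) by rewrite ceil_ge0; lra.
have /choice[Y YP] : forall i, exists Y : 'I_M -> R,
    (forall j, (closed_ball (X i) s `&` E) (Y j)) /\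
    (forall j j', j != j' -> r < `|Y j - Y j'|).
  move=> i; apply: exists_separated => // n b cov.
  have := (le_covering_numberP _ _ _ _).1 (dimE r s r0 rs krho (X i) (XE i)) n b cov.
  move=> le; rewrite -lez_nat gez0_abs // ceil_le_int.
  exact: le.
have YE i j : E (Y i j) by have [/(_ j)[]] := YP i.
have YX i j : X i - s <= Y i j <= X i + s.
  by have [/(_ j)[+ _] _] := YP i; rewrite closed_ball_itv //= in_itv.
have Ysep (p q : 'I_N * 'I_M) : p != q -> r <= `|Y p.1 p.2 - Y q.1 q.2|.
  case: p q => [i j] [i' j'] /=; have [->|ii _] := eqVneq i i'.
    by rewrite xpair_eqE eqxx /= => jj; have [_ /(_ j j' jj)/ltW] := YP i'.
  rewrite leNgt ltr_norml; apply/negP => /andP[h1 h2].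
  have := Xsep _ _ ii; rewrite ltNge ler_norml => /negP[].
  by have /andP[h3 h4] := YX i j; have /andP[h5 h6] := YX i' j'; apply/andP; split; lra.
have := complementary_separated_card R a E a0 hE
  ('I_N * 'I_M)%type (fun p => Y p.1 p.2) r (2 ^ m).-1 r0 (fun p => YE _ _) Ysep.
rewrite (tail m) -/r.
have -> : (2 ^ m).-1%:R = 2 ^+ m - 1 :> R.
  by rewrite -subn1 natrB ?expn_gt0 // natrX.
have -> : (2 ^+ m - 1) * r + 2 ^+ m * r + r = (2 * 2 ^+ m) * r by ring.
rewrite ler_pM2r // card_prod !card_ord natrM => NM.
have hN : 2 ^+ k <= 6 * N%:R :> R.
  by rewrite -natrX -natrM ler_nat /N; lia.
have hM : c * (s / r) `^ alpha <= M%:R.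
  by rewrite natr_absz ger0_norm // -ceil_le_int.
apply: (@le_trans _ _ (M%:R * (6 * N%:R))); last by lra.
by rewrite ler_pM // exprn_ge0.
Qed.

Theorem theorem12 (R : realType) (a : R^nat)
    (a_pos : forall j : nat, 0 < a j)
    (a_summable : cvgn (series a))
    (a_decreasing : forall j : nat, a j.+1 <= a j)
    (E : set R) (hE : complementary_set a E) :
  (lower_assouad_dim E <= lower_assouad_dim (cantor_set a))%E.
Proof.
have mean0 i : 0 < mean_length a i by exact: mean_length_gt0.
have anti := mean_length_anti R a a_pos a_summable.
apply: ge_ereal_sup => _ [alpha [c [rho [c0 rho0 dimE]]] <-].
apply: ereal_sup_ubound; exists alpha => //.
have nonempty_cover x r s n (b : 'I_n -> R) : 0 < s -> cantor_set a x ->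
    closed_ball x s `&` cantor_set a `<=` \bigcup_i closed_ball (b i) r -> (0 < n)%N.
  move=> s0 Cx cov; have [|i _ _] := cov x.
    by split=> //; rewrite closed_ball_itv //= in_itv /=; apply/andP; split; lra.
  by apply: leq_ltn_trans (ltn_ord i).
(* For alpha <= 0 one ball is already enough. *)
have [alpha0|alpha0] := lerP alpha 0.
  exists 1, 1; split=> // r s r0 rs _.
  apply: le_ereal_inf_tmp => _ [x Cx <-]; apply/le_covering_numberP => n b cov.
  have n1 := nonempty_cover _ _ _ _ _ (lt_trans r0 rs) Cx cov.
  rewrite mul1r; apply: (@le_trans _ _ 1); last by rewrite ler1n.
  by rewrite -[leRHS](powRr0 (s / r)) ler_powR // ler_pdivlMr // mul1r ltW.
have [K0 K0rho] := mean_length_lt R a a_pos rho rho0.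
(* 12 comes from the growth estimate; 2^5 pays for the five steps lost between
   m + 1 - k in that estimate and i below. *)
exists (c / (12 * 2 ^+ 5)), (mean_length a K0); split=> //.
  by rewrite divr_gt0 // mulr_gt0 ?exprn_gt0.
move=> r s r0 rs sK; have s0 := lt_trans r0 rs.
apply: le_ereal_inf_tmp => _ [x Cx <-]; apply/le_covering_numberP => n b cov.
(* s_(k+1) < s <= s_k and s_(m+1) <= r < s_m locate the two radii. *)
have := mean_length_lt R a a_pos s s0.
move=> /ex_minnP[[|k] ks kmin].
  by have := anti 0%N K0 isT; lra.
have kK0 : (K0 <= k)%N.
  rewrite leqNgt; apply/negP => /(anti k.+1 K0); lra.
have sk : s <= mean_length a k.
  by rewrite leNgt; apply/negP => h; have := kmin k h; rewrite ltnn.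
have : exists m, mean_length a m <= r.
  by have [m /ltW mr] := mean_length_lt R a a_pos r r0; exists m.
move=> /ex_minnP[m mr mmin].
have km : (k < m)%N by apply: kmin; lra.
case: m => // m in mr mmin km *.
have rm : r < mean_length a m.
  by rewrite ltNge; apply/negP => h; have := mmin m h; rewrite ltnn.
have growth : c * (s / r) `^ alpha <= 12 * 2 ^+ (m.+1 - k).
  rewrite expfB // mulrA ler_pdivlMr ?exprn_gt0 //.
  apply: le_trans (complementary_dim_growth R a E alpha c rho k m.+1 _ _ _ _ _ _ _ _) => //.
  - rewrite ler_pM2r ?exprn_gt0 // ler_pM2l // ge0_ler_powR ?nnegrE ?(ltW alpha0) //.
    + by rewrite divr_ge0 // ltW.
    + by rewrite divr_ge0 // ltW.
    + by rewrite ler_pM ?invr_ge0 ?(ltW s0) ?(ltW r0) // lef_pV2 ?posrE // ltW.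
  - move=> r' s' r'0 r's' s'rho y Ey; apply: le_trans (dimE r' s' r'0 r's' s'rho) _.
    by apply: ereal_inf_lbound; exists y.
  - by apply: le_lt_trans K0rho; exact: anti.
(* The subtraction is truncated: i = 0 when r and s are too close for the
   descendants to be useful. *)
pose i := (m - k - 4)%N.
have in_ : (2 ^ i <= n)%N.
  have [mk|mk] := leqP (k + 4) m; last first.
    have -> : i = 0%N by rewrite /i; clear -mk; lia.
    exact: nonempty_cover s0 Cx cov.
  apply: (cantor_cover_ge R a a_pos a_summable a_decreasing x s r k.+1 i n b) => //.
    exact: ltW.
  (* One step above m the mean length is at least twice as large, which gives
     the separation by 2 r. *)
  have -> : (k.+2 + i).+1 = m.-1 by rewrite /i; clear -mk; lia.
  have := mean_lengthS_le R a a_pos m.-1.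
  by rewrite prednK; [lra | clear -mk; lia].
have : (2 ^+ (m.+1 - k) : R) <= 2 ^+ 5 * n%:R.
  rewrite -!natrX -natrM ler_nat; apply: (@leq_trans (2 ^ 5 * 2 ^ i)).
    by rewrite -expnD leq_exp2l // /i; clear -km; lia.
  by rewrite leq_mul2l in_ orbT.
move=> pow_le; rewrite mulrAC ler_pdivrMr ?mulr_gt0 ?exprn_gt0 //.
apply: le_trans growth _.
by rewrite [leRHS]mulrC -mulrA ler_pM2l.
Qed.
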